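(* Let $\lambda,\mu,\nu,\delta,\rho$ be partitions with nonnegative parts (at most $n$ parts), $M\in\mathrm{HIVE}^\rho_{\lambda\delta}$, $N\in\mathrm{HIVE}^\delta_{\mu\nu}$, and let $P,Q$ be the hives produced from $(M,N)$ by the octahedron recurrence as in the context. Then $$R(\widehat M,\widehat N)=\widehat P\qquad\text{and}\qquad J(\widehat M\star\widehat N)=\widehat Q.$$
   Context: Let $\Delta_n=\{(x,y,z)\in\mathbb Z_{\ge0}^3:x+y+z=n\}$. A function $P:\Delta_n\to\mathbb Z$ satisfies the hive condition if (whenever all points lie in $\Delta_n$) (i) $P(x,y,z)+P(x,y+1,z-1)\ge P(x+1,y,z-1)+P(x-1,y+1,z)$, (ii) $P(x,y,z)+P(x+1,y,z-1)\ge P(x,y+1,z-1)+P(x+1,y-1,z)$, (iii) $P(x,y,z)+P(x+1,y-1,z)\ge P(x+1,y,z-1)+P(x,y-1,z+1)$; a hive is such a function modulo constants. $\mathrm{HIVE}^\nu_{\lambda\mu}$: hives with $\lambda_k=P(n-k,k,0)-P(n-k+1,k-1,0)$, $\mu_k=P(k,0,n-k)-P(k-1,0,n-k+1)$, $\nu_k=P(0,k,n-k)-P(0,k-1,n-k+1)$. Construction of $P,Q$: choose representatives with $M(k,0,n-k)=N(0,k,n-k)$ for all $k$. Let $\mathcal L=\{(x,y,t)\in\mathbb Z^3:0\le x,y\le n,\ x+y+t\text{ even}\}$. Define $f$ on the points with $t=|x-y|$ by $f(x,n-z,y)=M(x,y,z)$ and $f(n-z,y,x)=N(x,y,z)$,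 $(x,y,z)\in\Delta_n$. Extend $f$, inductively in $t$, to all points of $\mathcal L$ in $A=\{|x-y|\le t\le n-|n-x-y|\}$ by $f(x,y,t+1)=\max(f(x+1,y,t)+f(x-1,y,t),f(x,y+1,t)+f(x,y-1,t))-f(x,y,t-1)$. Set $P(x,y,z)=f(n-y,n-z,n-x)$ and $Q(x,y,z)=f(x,y,n-z)$. For any $P:\Delta_n\to\mathbb Z$, $\widehat P(i,j)=P(i-j,j,n-i)-P(i-j+1,j-1,n-i)$, $1\le j\le i\le n$; for hives this is a Gelfand–Tsetlin pattern, identified with the tableau $T$ (entries in $\{1..n\}$, rows weakly and columns strictly increasing) with $T(i,j)=\#\{\text{entries}\le i\text{ in row }j\}$; $\widehat M$ has shape $\lambda$ and $\widehat N$ has shape $\mu$. For tableaux $T$ (shape $\lambda$), $U$ (shape $\mu$): $T\star U$ is the skew tableau with $U$ up and to the right of $T$ (rows $r\le n$: row $r$ of $U$ in columns $\lambda_1+1..\lambda_1+\mu_r$; rows $n+r$: row $r$ of $T$ in columns $1..\lambda_r$); $J(X)$ is jeu de taquin rectification. $J^n=T$, $J^{k-1}=((J^k\leftarrow a_1)\leftarrow\cdots)\leftarrow a_l$ with $a_1\le\dots\le a_l$ the entries of row $k$ of $U$ ($\leftarrow$ = row insertion); $\lambda^k$ = shape of $J^k$; $R(T,U)(i,j)=\sum_{r\ge j}\lambda^{i-j+1}_r-\sum_{r\ge j+1}\lambda^{i-j}_r$. *)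

(* Defs.v *)
From mathcomp Require Import all_boot all_order all_algebra.

Set Implicit Arguments.
Unset Strict Implicit.
Unset Printing Implicit Defensive.

Import Order.TTheory GRing.Theory Num.Theory.
Local Open Scope ring_scope.

(** * Hives *)

(* A function on the simplex [Delta n] is encoded as a function on Z^3 of which
   only the values on [Delta n] matter. *)
Definition Delta (n : nat) (x y z : int) : bool :=
  [&& 0 <= x, 0 <= y, 0 <= z & x + y + z == n%:Z].

Definition hive (n : nat) (P : int -> int -> int -> int) : Prop :=
  [/\ forall x y z,
        Delta n x y z -> Delta n x (y + 1) (z - 1) ->
        Delta n (x + 1) y (z - 1) -> Delta n (x - 1) (y + 1) z ->
        P x y z + P x (y + 1) (z - 1) >= P (x + 1) y (z - 1) + P (x - 1) (y + 1) z,
      forall x y z,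
        Delta n x y z -> Delta n (x + 1) y (z - 1) ->
        Delta n x (y + 1) (z - 1) -> Delta n (x + 1) (y - 1) z ->
        P x y z + P (x + 1) y (z - 1) >= P x (y + 1) (z - 1) + P (x + 1) (y - 1) z
    & forall x y z,
        Delta n x y z -> Delta n (x + 1) (y - 1) z ->
        Delta n (x + 1) y (z - 1) -> Delta n x (y - 1) (z + 1) ->
        P x y z + P (x + 1) (y - 1) z >= P (x + 1) y (z - 1) + P x (y - 1) (z + 1)].

Definition partition_n (n : nat) (lam : n.-tuple nat) : Prop := sorted geq lam.

(* The [k]-th part, [1 <= k <= n]. *)
Definition part (n : nat) (lam : n.-tuple nat) (k : nat) : int :=
  (nth 0%N lam k.-1)%:Z.

(* [P] represents an element of HIVE^nu_{lam mu}; hives are functions modulo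
   constants, and the conditions below are invariant under adding a constant. *)
Definition HIVE (n : nat) (lam mu nu : n.-tuple nat)
    (P : int -> int -> int -> int) : Prop :=
  hive n P /\
  forall k : nat, (1 <= k <= n)%N ->
    [/\ part lam k = P (n%:Z - k%:Z) k%:Z 0 - P (n%:Z - k%:Z + 1) (k%:Z - 1) 0,
        part mu k = P k%:Z 0 (n%:Z - k%:Z) - P (k%:Z - 1) 0 (n%:Z - k%:Z + 1)
      & part nu k = P 0 k%:Z (n%:Z - k%:Z) - P 0 (k%:Z - 1) (n%:Z - k%:Z + 1)].

(** * The octahedron recurrence *)

Definition lattice (n : nat) (x y t : int) : bool :=
  [&& 0 <= x <= n%:Z, 0 <= y <= n%:Z & (2 %| x + y + t)%Z].

Definition regionA (n : nat) (x y t : int) : bool :=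
  `|x - y| <= t <= n%:Z - `|n%:Z - x - y|.

(* [f] is determined by [M] and [N] on the points of [lattice n] in [regionA n];
   its values elsewhere are irrelevant. *)
Definition octahedron (n : nat) (M N f : int -> int -> int -> int) : Prop :=
  [/\ forall x y z, Delta n x y z -> f x (n%:Z - z) y = M x y z,
      forall x y z, Delta n x y z -> f (n%:Z - z) y x = N x y z
    & forall x y t,
        lattice n x y (t + 1) -> regionA n x y (t + 1) -> `|x - y| < t + 1 ->
        f x y (t + 1) =
          Num.max (f (x + 1) y t + f (x - 1) y t) (f x (y + 1) t + f x (y - 1) t)
          - f x y (t - 1)].

Definition hiveP (n : nat) (f : int -> int -> int -> int) (x y z : int) : int :=
  f (n%:Z - y) (n%:Z - z) (n%:Z - x).

Definition hiveQ (n : nat) (f : int -> int -> int -> int) (x y z : int) : int :=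
  f x y (n%:Z - z).

(** * Gelfand-Tsetlin patterns and tableaux *)

Definition hat (n : nat) (P : int -> int -> int -> int) (i j : nat) : int :=
  P (i%:Z - j%:Z) j%:Z (n%:Z - i%:Z)
  - P (i%:Z - j%:Z + 1) (j%:Z - 1) (n%:Z - i%:Z).

(* A filling is its sequence of rows, from top to bottom; trailing empty rows
   are allowed and carry no information. *)
Definition tableau (n : nat) (T : seq (seq nat)) : Prop :=
  [/\ forall s, s \in T -> sorted leq s,
      forall s, s \in T -> all (fun a => (1 <= a <= n)%N) s
    & forall r c, (c < size (nth [::] T r.+1))%N ->
        (c < size (nth [::] T r))%N /\
        (nth 0 (nth [::] T r) c < nth 0 (nth [::] T r.+1) c)%N].

(* T(i, j), the number of entries at most [i] in row [j >= 1]. *)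
Definition pattern (T : seq (seq nat)) (i j : nat) : nat :=
  count (fun a => a <= i)%N (nth [::] T j.-1).

(* [T] is the tableau identified with the pattern [G(i, j)], 1 <= j <= i <= n. *)
Definition tableau_of (n : nat) (G : nat -> nat -> int) (T : seq (seq nat)) : Prop :=
  tableau n T /\
  forall i j : nat, (1 <= j <= i)%N -> (i <= n)%N -> (pattern T i j)%:Z = G i j.

(** * Jeu de taquin *)

(* Rows of a skew tableau, [None] standing for a box of the inner shape. *)
Definition skew := seq (seq (option nat)).

Definition star (n : nat) (T U : seq (seq nat)) : skew :=
  mkseq (fun r => nseq (size (head [::] T)) None ++ map Some (nth [::] U r)) n
  ++ mkseq (fun r => map Some (nth [::] T r)) n.

Definition entry (X : skew) (r c : nat) : option nat :=
  nth None (nth [::] X r) c.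

Definition set_entry (X : skew) (r c : nat) (v : option nat) : skew :=
  set_nth [::] X r (set_nth None (nth [::] X r) c v).

(* Moves the hole at (r, c) right or down until it leaves the skew shape; of the
   two neighbours the smaller one slides into the hole, and the lower one if they
   are equal.  [fuel] bounds the number of moves. *)
Fixpoint slide (fuel : nat) (X : skew) (r c : nat) : skew :=
  if fuel is fuel'.+1 then
    let from_right a := slide fuel' (set_entry X r c (Some a)) r c.+1 in
    let from_below b := slide fuel' (set_entry X r c (Some b)) r.+1 c in
    match entry X r c.+1, entry X r.+1 c with
    | None, None => set_nth [::] X r (take c (nth [::] X r))
    | Some a, None => from_right a
    | None, Some b => from_below b
    | Some a, Some b => if (b <= a)%N then from_below b else from_right a
    end
  else X.

Definition inner_size (X : skew) (r : nat) : nat := count_mem None (nth [::] X r).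

(* One slide, into the lowest inside corner (the last box of the inner shape in
   the last row meeting it). *)
Definition jdt_step (X : skew) : skew :=
  let rows := [seq r <- iota 0 (size X) | (0 < inner_size X r)%N] in
  if rows is r0 :: rs then
    let r := last r0 rs in
    slide (size (flatten X)) X r (inner_size X r).-1
  else X.

(* The rectification does not depend on the inside corners chosen; each slide
   fills exactly one box of the inner shape. *)
Definition J (X : skew) : seq (seq nat) :=
  map (pmap id) (iter (count_mem None (flatten X)) jdt_step X).

(** * Row insertion *)

Fixpoint row_insert (T : seq (seq nat)) (a : nat) : seq (seq nat) :=
  if T is s :: T' then
    let i := find (fun b => a < b)%N s in
    if (i < size s)%N then set_nth 0%N s i a :: row_insert T' (nth 0%N s i)
    else rcons s a :: T'
  else [:: [:: a]].

(* J^k: the rows n, n - 1, ..., k + 1 of [U] are inserted into [T], in this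
   order, each of them from left to right. *)
Definition Jstage (T U : seq (seq nat)) (k : nat) : seq (seq nat) :=
  foldr (fun s S => foldl row_insert S s) T (drop k U).

(* lambda^k_j + lambda^k_{j+1} + ..., where lambda^k is the shape of J^k. *)
Definition tail_size (T U : seq (seq nat)) (k j : nat) : nat :=
  sumn (drop j.-1 (shape (Jstage T U k))).

Definition Rpat (T U : seq (seq nat)) (i j : nat) : int :=
  (tail_size T U (i - j).+1 j)%:Z - (tail_size T U (i - j) j.+1)%:Z.

(* Main.v *)
(* Both claims follow from an explicit solution of the recurrence. Let J^c be the
   tableau obtained from T by inserting the rows n, ..., c+1 of U, and let
   x <= y <= ... be a word inserted into a row R, giving R'. If #_i counts the
   letters <= i, then Lindley's recursion
     #_{i+1} R' = max(#_i R', #_{i+1} R) + (number of letters i+1 in the word)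
   holds, and the bumped letters form an increasing word that is inserted into
   the next row. Summed over the first b rows it is the octahedron recurrence for
     f(i-b, b+c, i-c) = N(i,0,n-i) + #_i(first c rows of U) + #_i(first b rows of J^c).
   The face c = 0 gives Q and the face i = n gives P.

   For the rectification, the slides starting in row r of U shift this row over
   the straight tableau below it, and each of them turns a pair (row s, tableau Y)
   into a pair (s', Y') with Y <- s = Y' <- s'. When the row has reached the left
   border it is simply the first row of Y' <- s', so the slides of row r perform
   its insertion. *)

Require Import Defs.
From mathcomp Require Import all_boot all_order all_algebra.
From mathcomp Require Import zify.

Import Order.TTheory GRing.Theory Num.Theory.
Local Open Scope nat_scope.

(** * Insertion of an increasing word *)

Fixpoint ins (R : seq nat) (a : nat) : seq nat :=
  if R is b :: R' then if a < b then a :: R' else b :: ins R' a else [:: a].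

(** A list of at most one letter, so that inserting [bumped R a] into the rows below also covers the
    case without bumping. *)
Fixpoint bumped (R : seq nat) (a : nat) : seq nat :=
  if R is b :: R' then if a < b then [:: b] else bumped R' a else [::].

(* The word passed on to the next row when [s] is inserted into the row [R]. *)
Fixpoint bumps (R s : seq nat) : seq nat :=
  if s is a :: s' then bumped R a ++ bumps (ins R a) s' else [::].

Local Notation insert_row := (foldl row_insert).

Lemma row_insert_cons (R : seq nat) (Z : seq (seq nat)) (a : nat) :
  row_insert (R :: Z) a = ins R a :: insert_row Z (bumped R a).
Proof.
have -> : row_insert (R :: Z) a =
    (if find (fun b => a < b) R < size R
     then set_nth 0 R (find (fun b => a < b) R) a
            :: row_insert Z (nth 0 R (find (fun b => a < b) R))
     else rcons R a :: Z) by [].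
elim: R => [|b R IH] //=; case: (ltnP a b) => //= ab.
by rewrite ltnS; move: IH; case: ifP => _ [-> {1}->].
Qed.

Lemma insert_row_cons (R : seq nat) (Z : seq (seq nat)) (s : seq nat) :
  insert_row (R :: Z) s = foldl ins R s :: insert_row Z (bumps R s).
Proof.
elim: s R Z => [|a s IH] R Z //.
rewrite -[LHS]/(insert_row (row_insert (R :: Z) a) s).
by rewrite row_insert_cons IH /= foldl_cat.
Qed.

Lemma insert_row0 (T : seq (seq nat)) (s : seq nat) :
  nth [::] (insert_row T s) 0 = foldl ins (head [::] T) s.
Proof.
case: T => [|R Z]; last by rewrite insert_row_cons.
by case: s => [|a s] //; rewrite -[X in nth _ X]/(insert_row [:: [:: a]] s) insert_row_cons.
Qed.

Lemma insert_rowS (T : seq (seq nat)) (s : seq nat) (r : nat) :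
  nth [::] (insert_row T s) r.+1 =
  nth [::] (insert_row (behead T) (bumps (head [::] T) s)) r.
Proof.
case: T => [|R Z]; last by rewrite insert_row_cons.
case: s => [|a s]; first by rewrite !nth_nil.
by rewrite -[X in nth _ X]/(insert_row [:: [:: a]] s) insert_row_cons.
Qed.

(** Tableaux may differ by trailing empty rows, so they are compared through their row functions;
    insertion respects this. *)
Lemma eq_insert_row (T T' : seq (seq nat)) (s : seq nat) :
  nth [::] T =1 nth [::] T' ->
  nth [::] (insert_row T s) =1 nth [::] (insert_row T' s).
Proof.
move=> eqT r; elim: r T T' s eqT => [|r IH] T T' s eqT.
  by rewrite !insert_row0 -!nth0 eqT.
rewrite !insert_rowS -!nth0 eqT; apply: IH => k.
by rewrite !nth_behead eqT.
Qed.

Lemma all_ins (p : pred nat) (R : seq nat) (a : nat) :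
  all p R -> p a -> all p (ins R a).
Proof.
elim: R => [|b R IH] /= => [_ -> //|/andP[pb pR] pa].
by case: ifP => _ /=; rewrite ?pa ?pb ?pR ?IH.
Qed.

Lemma all_bumped (p : pred nat) (R : seq nat) (a : nat) :
  all p R -> all p (bumped R a).
Proof.
elim: R => [|b R IH] //= /andP[pb pR].
by case: ifP => _ /=; rewrite ?pb ?IH.
Qed.

Lemma all_foldl_ins (p : pred nat) (R s : seq nat) :
  all p R -> all p s -> all p (foldl ins R s).
Proof. by elim: s R => [|a s IH] R //= pR /andP[pa ps]; apply/IH/ps/all_ins. Qed.

Lemma all_bumps (p : pred nat) (R s : seq nat) :
  all p R -> all p s -> all p (bumps R s).
Proof.
elim: s R => [|a s IH] R //= pR /andP[pa ps].
by rewrite all_cat all_bumped // IH // all_ins.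
Qed.

Lemma all_insert_row (p : pred nat) (T : seq (seq nat)) (s : seq nat) :
  (forall r, all p (nth [::] T r)) -> all p s ->
  forall r, all p (nth [::] (insert_row T s) r).
Proof.
move=> pT ps r; elim: r T s pT ps => [|r IH] T s pT ps.
  by rewrite insert_row0 -nth0 all_foldl_ins.
rewrite insert_rowS -nth0; apply: IH => [k|]; first by rewrite nth_behead.
exact: all_bumps.
Qed.

Lemma sorted_ins (R : seq nat) (a : nat) : sorted leq R -> sorted leq (ins R a).
Proof.
elim: R => [|b R IH] //= bR; case: (ltnP a b) => /= ab.
  by rewrite path_min_sorted ?(path_sorted bR) //;
     apply/allP=> x /(allP (order_path_min leq_trans bR)) ; lia.
rewrite path_min_sorted ?IH ?(path_sorted bR) //.
by apply: all_ins => //; apply: order_path_min bR; apply: leq_trans.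
Qed.

Lemma sorted_foldl_ins (R s : seq nat) :
  sorted leq R -> sorted leq (foldl ins R s).
Proof. by elim: s R => [|a s IH] R //= sR; apply/IH/sorted_ins. Qed.

(* Every bumped letter exceeds [a], and an inserted letter is never bumped again
   because the word is increasing. *)
Lemma bumps_ge (d a : nat) (R s : seq nat) :
  path leq a s -> all (fun x => (x <= a) || (d <= x)) R ->
  all (leq d) (bumps R s).
Proof.
elim: s a R => [|b s IH] a R //= /andP[ab bs] aR; rewrite all_cat.
apply/andP; split; last first.
  apply: IH bs _; apply: all_ins; last by rewrite leqnn.
  by apply: sub_all aR => x; lia.
elim: R aR {IH} => [|c R IH] //= /andP[cP aR].
by case: (ltnP b c) => [bc|_] /=; [rewrite andbT; lia | apply: IH].
Qed.

Lemma sorted_bumps (R s : seq nat) :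
  sorted leq R -> sorted leq s -> sorted leq (bumps R s).
Proof.
elim: s R => [|a s IH] R //= sR a_s.
have sB := IH _ (sorted_ins _ a sR) (path_sorted a_s).
(* Once [a] has replaced the first bumped letter [d], every letter of the row is [<= a] or [>= d],
   so [bumps_ge] makes all later bumped letters [>= d]. *)
suff : bumped R a = [::] \/
    exists2 d, bumped R a = [:: d] & all (fun x => (x <= a) || (d <= x)) (ins R a).
  case=> [-> //|[d -> dR]] /=.
  by rewrite path_min_sorted // (bumps_ge _ _ _ _ a_s dR).
elim: R sR {IH sB a_s} => [|b R IH] /= => [_|bR]; first by left.
case: (ltnP a b) => /= ab; [right; exists b | move: (IH (path_sorted bR))] => //.
  rewrite leqnn /=; apply: sub_all (order_path_min leq_trans bR) => x ->.
  by rewrite orbT.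
by case=> [->|[d -> dR]]; [left | right; exists d; rewrite //= ab].
Qed.

(** * Counting letters: Lindley's recursion and its sum over rows *)

Definition cnt (i : nat) (s : seq nat) : nat := count (fun a => a <= i) s.
Arguments cnt : simpl never.

Lemma cnt_nil i : cnt i [::] = 0.
Proof. by []. Qed.

Lemma cnt_cons i a s : cnt i (a :: s) = (a <= i) + cnt i s.
Proof. by []. Qed.

Lemma cnt_cat i s1 s2 : cnt i (s1 ++ s2) = cnt i s1 + cnt i s2.
Proof. exact: count_cat. Qed.

Definition cntE := (cnt_nil, cnt_cons, cnt_cat).

Lemma cnt_ins i R a : cnt i (ins R a) + cnt i (bumped R a) = cnt i R + (a <= i).
Proof. by elim: R => [|b R IH] /=; [| case: (ltnP a b) => _]; rewrite !cntE; lia. Qed.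

Lemma cnt_foldl_ins i R s :
  cnt i (foldl ins R s) + cnt i (bumps R s) = cnt i R + cnt i s.
Proof.
elim: s R => [|a s IH] R //=.
rewrite !cntE; have := cnt_ins i R a; have := IH (ins R a); lia.
Qed.

Lemma leq_cnt_foldl_ins i R s : cnt i R <= cnt i (foldl ins R s).
Proof.
elim: s R => [|a s IH] R //=; apply: leq_trans (IH _).
by elim: R {IH} => [|b R IH] /=; [| case: (ltnP a b) => ab]; rewrite !cntE; lia.
Qed.

Lemma cnt_foldl_ins_gt i R s :
  all (ltn i) s -> cnt i (foldl ins R s) = cnt i R.
Proof.
elim: s R => [|a s IH] R //= /andP[ia /IH ->].
by elim: R {IH} => [|b R IH] /=; [| case: (ltnP a b) => ab]; rewrite !cntE; lia.
Qed.

Lemma cnt_foldl_insS i R s : sorted leq R -> sorted leq s ->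
  cnt i.+1 (foldl ins R s) + cnt i s =
  maxn (cnt i (foldl ins R s)) (cnt i.+1 R) + cnt i.+1 s.
Proof.
elim: s R => [|a s IH] R /= sR a_s; rewrite !cntE.
  by rewrite !addn0; apply/esym/maxn_idPr/sub_count => x /=; lia.
have {IH} := IH _ (sorted_ins _ a sR) (path_sorted a_s).
have mono := leq_cnt_foldl_ins i (ins R a) s.
case: (ltngtP a i.+1) => [ai|ai|ai].
(* A letter [a <= i] raises the count of letters [<= i+1] only if it bumps none of them. Then the
   letters [<= i+1] of the new row are all [<= a], and by [mono] the maximum is attained by the
   count at [i]. *)
- suff : cnt i.+1 R <= cnt i.+1 (ins R a) <= maxn (cnt i.+1 R) (cnt i (ins R a)) by lia.
  rewrite (leq_cnt_foldl_ins _ _ [:: a]) /=.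
  elim: R sR {mono} => [|b R IH] /= => [_|bR]; first by rewrite !cntE; lia.
  case: (ltnP a b) => /= ab; rewrite !cntE; last by have := IH (path_sorted bR); lia.
  case: (leqP b i.+1) => bi; first lia.
  suff : cnt i.+1 R = 0 by lia.
  apply/eqP; rewrite -leqn0 leqNgt -has_count; apply/hasPn => x.
  by move/(allP (order_path_min leq_trans bR)) => /=; lia.
- by have := cnt_foldl_ins_gt i.+1 R [:: a]; rewrite /= ai => /(_ isT); lia.
(* For [a = i+1] the whole remaining word exceeds [i]: the count at [i] is frozen, and [a] raises
   the count at [i+1] by one. *)
suff : cnt i (foldl ins (ins R a) s) = cnt i R /\ cnt i.+1 (ins R a) = (cnt i.+1 R).+1.
  have : cnt i R <= cnt i.+1 R by apply: sub_count => x /=; lia.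
  by lia.
split.
  apply: (cnt_foldl_ins_gt i R (a :: s)) => /=; rewrite ai ltnSn /=.
  by apply: sub_all (order_path_min leq_trans a_s) => x /=; lia.
elim: R {sR mono} => [|b R IH] //=; first by rewrite !cntE; lia.
by case: (ltnP a b) => ab; rewrite !cntE; lia.
Qed.

Definition rowsum (V : seq (seq nat)) (i b : nat) : nat :=
  \sum_(r < b) cnt i (nth [::] V r).

Lemma rowsum0 V i : rowsum V i 0 = 0.
Proof. by rewrite /rowsum big_ord0. Qed.

Lemma rowsumS V i b :
  rowsum V i b.+1 = cnt i (head [::] V) + rowsum (behead V) i b.
Proof.
rewrite /rowsum big_ord_recl -nth0; congr (_ + _).
by apply: eq_bigr => r _; rewrite nth_behead.
Qed.

Lemma rowsum_insert_rowS V s i b :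
  rowsum (insert_row V s) i b.+1 =
  cnt i (foldl ins (head [::] V) s)
  + rowsum (insert_row (behead V) (bumps (head [::] V) s)) i b.
Proof.
rewrite rowsumS -nth0 insert_row0 /rowsum; congr (_ + _).
by apply: eq_bigr => r _; rewrite nth_behead insert_rowS.
Qed.

(** Induction after removing the first row: below it the increasing word [bumps] is inserted, and
    conservation of letters ([cnt_foldl_ins]) trades its counts for those of [s]. *)
Lemma rowsum_insert_row V s i b :
  (forall r, sorted leq (nth [::] V r)) -> sorted leq s ->
  rowsum (insert_row V s) i.+1 b.+1 + rowsum V i b + cnt i s =
  maxn (rowsum V i.+1 b + rowsum (insert_row V s) i b.+1)
       (rowsum V i.+1 b.+1 + rowsum (insert_row V s) i b) + cnt i.+1 s.
Proof.
move=> sV ss; elim: b V s sV ss => [|b IH] V s sV ss.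
  rewrite !rowsum_insert_rowS rowsumS !rowsum0.
  have := cnt_foldl_insS i _ _ (sV 0) ss; rewrite nth0; lia.
have sV' r : sorted leq (nth [::] (behead V) r) by rewrite nth_behead.
have := IH _ _ sV' (sorted_bumps _ _ (sV 0) ss).
rewrite nth0 !(rowsum_insert_rowS _ _ _ b.+1) !(rowsumS _ _ b.+1).
rewrite !(rowsum_insert_rowS V _ _ b) !(rowsumS V _ b).
have := cnt_foldl_ins i (head [::] V) s.
have := cnt_foldl_ins i.+1 (head [::] V) s.
lia.
Qed.

Lemma bumps_gt c R s : all (ltn c) s -> all (ltn c.+1) (bumps R s).
Proof.
elim: s R => [|a s IH] R //= /andP[ca cs]; rewrite all_cat IH // andbT.
elim: R {IH} => [|b R IH] //=; case: (ltnP a b) => //= ab; lia.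
Qed.

(** Letters grow by at least one with each row they are passed to, so those leaving the first [b]
    rows exceed [b + c >= i]. *)
Lemma rowsum_insert_row_gt V s i b c : all (ltn c) s -> i <= b + c ->
  rowsum (insert_row V s) i b = rowsum V i b + cnt i s.
Proof.
elim: b V s c => [|b IH] V s c cs ib.
  rewrite !rowsum0; apply/esym/eqP; rewrite -leqn0 leqNgt -has_count.
  by apply/hasPn => x /(allP cs) /=; lia.
rewrite rowsum_insert_rowS (IH _ _ c.+1) ?bumps_gt //; last lia.
by rewrite rowsumS; have := cnt_foldl_ins i (head [::] V) s; lia.
Qed.

Lemma sumn_shape_insert_row T s :
  sumn (shape (insert_row T s)) = sumn (shape T) + size s.
Proof.
elim: s T => [|a s IH] T /=; first by rewrite addn0.
rewrite {}IH addnS -addSn; congr (_ + _).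
elim: T a => [|R Z IH] a //=; case: ifP => iR /=; last by rewrite size_rcons.
by rewrite IH size_set_nth; lia.
Qed.

(** * Slides *)

Fixpoint above (A B : seq nat) : bool :=
  if B is b :: B' then if A is a :: A' then (a < b) && above A' B' else false
  else true.
Arguments above !A !B.

Lemma above_nil A : above A [::].
Proof. by case: A. Qed.

Lemma above_catl A1 A2 B :
  above (A1 ++ A2) B = above A1 (take (size A1) B) && above A2 (drop (size A1) B).
Proof.
by elim: A1 B => [|a A1 IH] [|b B] //=; rewrite ?above_nil // IH andbA.
Qed.

Lemma above_cat A1 A2 B1 B2 : size A1 = size B1 ->
  above (A1 ++ A2) (B1 ++ B2) = above A1 B1 && above A2 B2.
Proof. by move=> e; rewrite above_catl e take_size_cat ?drop_size_cat. Qed.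

Lemma above_nthP A B :
  reflect (forall j, j < size B -> j < size A /\ nth 0 A j < nth 0 B j) (above A B).
Proof.
apply: (iffP idP) => [|].
  by elim: B A => [|b B IH] [|a A] //= /andP[ab AB] [|j] //= /(IH _ AB).
elim: B A => [|b B IH] [|a A] //= H; first by have [] := H 0.
by have [_ /= -> /=] := H 0 isT; apply: IH => j /(H j.+1).
Qed.

Lemma above_drop A B k : above A B -> above (drop k A) (drop k B).
Proof.
by elim: k A B => [|k IH] [|a A] [|b B] //=; rewrite ?above_nil // => /andP[_ /IH].
Qed.

Lemma above_cons s B y : above s B -> path leq y s -> above (y :: s) B.
Proof.
by elim: s B y => [|a s IH] [|b B] y //= /andP[ab sB] /andP[ya /(IH _ _ sB) ->]; lia.
Qed.

(** The letter over [z] is [y] if [t1] is empty; otherwise it is smaller than the last letter of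
    [t1], hence than [z]. *)
Lemma above_consI s t1 t2 y z : above s (t1 ++ t2) -> path leq y s ->
  all (gtn z) t1 -> (t1 = [::] -> y < z) -> above (y :: s) (t1 ++ z :: t2).
Proof.
elim: t1 s y => [|t t1 IH] s y /=; first by move=> -> _ _ ->.
case: s => [|a s] //=.
move=> /andP[at_ st] /andP[ya ys] /andP[tz tz1] _.
by rewrite (IH _ a) // => [|_]; lia.
Qed.

(** [drop k s] is the part of [s] under [u] when [s] starts [k] columns further left. One more shift
    to the left puts under each letter of [u] the next, not smaller, letter of [s]. *)
Lemma above_shift u k s : above u (drop k s) -> sorted leq s ->
  above u (drop k.+1 s).
Proof.
move=> us ss; apply/above_nthP => j; rewrite size_drop => jk.
have [|ju] := above_nthP _ _ us j; first by rewrite size_drop; lia.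
rewrite !nth_drop => lt; split=> //; apply: leq_trans lt _.
by apply: (sorted_leq_nth leq_trans leqnn) => //; rewrite ?inE /=; lia.
Qed.

(** Here [t1] moves one column left, [z] fills the gap and [t2] keeps its columns. *)
Lemma above_shiftI u k t1 t2 z : above u (drop k (t1 ++ t2)) ->
  sorted leq t1 -> all (gtn z) t1 -> above u (drop k.+1 (t1 ++ z :: t2)).
Proof.
move=> us ss tz; apply/above_nthP => j; rewrite size_drop size_cat /= => jk.
have [|ju] := above_nthP _ _ us j; first by rewrite size_drop size_cat; lia.
rewrite !nth_drop => lt; split=> //; apply: leq_trans lt _.
rewrite !nth_cat; case: ltnP => h1; case: ltnP => h2; try lia.
- by apply: (sorted_leq_nth leq_trans leqnn) => //; rewrite ?inE /=; lia.
- have -> : k.+1 + j - size t1 = 0 by lia.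
  by apply: ltnW; apply: (allP tz); rewrite mem_nth.
have -> : k.+1 + j - size t1 = (k + j - size t1).+1 by lia.
by [].
Qed.

(** * The slide of a hole as a relation *)

Fixpoint tab (Y : seq (seq nat)) : bool :=
  if Y is R :: Z then [&& sorted leq R, above R (head [::] Z) & tab Z] else true.

(* [slid c B Y B' Y']: a hole in column [c], with the letters [B] to its right
   and the rows [Y] below, slides out of the shape and leaves [B'] from column
   [c] on and the rows [Y']. The letters [t1] move left before [z] moves up. *)
Inductive slid : nat -> seq nat -> seq (seq nat) -> seq nat -> seq (seq nat) -> Prop :=
| slid_stop c B Y : above B (drop c (head [::] Y)) -> slid c B Y B Y
| slid_down c t1 t2 z Z1 Z2 Z2' W W' :
    size Z1 = c + size t1 -> above t1 (drop c Z1) -> all (gtn z) t1 ->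
    path leq z t2 -> above t2 Z2 -> slid (size Z1) Z2 W Z2' W' ->
    slid c (t1 ++ t2) ((Z1 ++ z :: Z2) :: W) (t1 ++ z :: t2) ((Z1 ++ Z2') :: W').

(** The hole first moves right past [b], which happens when the letter below the hole is larger than
    [b] or missing. *)
Lemma slid_cons c b B Y B' Y' : slid c.+1 B Y B' Y' -> sorted leq (head [::] Y) ->
  (c < size (head [::] Y) -> b < nth 0 (head [::] Y) c) ->
  slid c (b :: B) Y (b :: B') Y'.
Proof.
move=> sl; move e: c.+1 sl => c' sl.
case: sl e => {c' B Y B' Y'} [c' B Y H|c' t1 t2 z Z1 Z2 Z2' W W' sZ H1 H2 H3 H4 H5] e sY bY; subst c'.
  apply: slid_stop; case: (ltnP c (size (head [::] Y))) => cY; last by rewrite drop_oversize.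
  by rewrite (drop_nth 0) //= bY.
have cZ : c < size Z1 by lia.
move: bY sY => /=; rewrite size_cat nth_cat cZ => bY sY.
have {}bY : b < nth 0 Z1 c by apply: bY; lia.
apply: (slid_down _ (b :: t1)) => //=; first by lia.
  by rewrite (drop_nth 0) //= bY.
rewrite H2 andbT; apply: leq_trans bY _.
move: sY; rewrite (sorted_pairwise leq_trans) pairwise_cat /= => /and3P[/allrelP sY _ _].
by apply: sY; rewrite ?mem_nth ?mem_head.
Qed.

Lemma slid_prefix c b B Y B' Y' : slid (c + size b) B Y B' Y' ->
  sorted leq (head [::] Y) -> above b (take (size b) (drop c (head [::] Y))) ->
  slid c (b ++ B) Y (b ++ B') Y'.
Proof.
elim: b c => [|x b IH] c /=; first by rewrite addn0.
rewrite addnS -addSn => sl sY H; apply: slid_cons => //.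
  apply: IH => //; case: (ltnP c (size (head [::] Y))) => cY.
    by move: H; rewrite (drop_nth 0) //= => /andP[].
  by rewrite drop_oversize ?above_nil //; lia.
by move=> cY; move: H; rewrite (drop_nth 0) //= => /andP[].
Qed.

(* If [y] has moved up out of the hole and is followed there by [s], the strict
   increase down the columns still holds once the slide is finished. *)
Lemma slid_above_hole c B Y B' Y' A y s : slid c B Y B' Y' ->
  size A = c -> above (A ++ y :: B) (head [::] Y) -> path leq y B ->
  path leq y s -> above s B -> above (y :: s) B'.
Proof.
case=> {c B Y B' Y'} [c B Y _|c t1 t2 z Z1 Z2 Z2' W W' sZ H1 H2 H3 H4 H5] sA AY yB ys sB.
  exact: above_cons.
apply: above_consI => // t10; move: AY sZ; rewrite t10 /= addn0 -sA => AY sZ.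
by move: AY; rewrite above_cat //= => /and3P[].
Qed.

(** The last clause, that nothing left of the hole changes, is what the induction needs to restore
    the column condition between [Z1 ++ Z2'] and the row below it. *)
Lemma slid_tab c B Y B' Y' : slid c B Y B' Y' -> tab Y -> sorted leq B ->
  [/\ sorted leq B', tab Y', above B' (drop c (head [::] Y'))
    & take c (head [::] Y') = take c (head [::] Y)].
Proof.
elim=> {c B Y B' Y'} [c B Y H|c t1 t2 z Z1 Z2 Z2' W W' sZ H1 H2 H3 H4 H5 IH] //=.
move=> /and3P[sZZ aW tW].
rewrite !(sorted_pairwise leq_trans) !pairwise_cat in sZZ *.
case/and3P: sZZ => /allrelP s1 s2; rewrite /= -(sorted_pairwise leq_trans) => /andP[s3 s4].
case/and3P=> /allrelP s5 s6 s7.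
have [i1 i2 i3 i4] := IH tW s4.
have zZ2 : path leq z Z2 by rewrite path_min_sorted.
have aZ2' : above (z :: t2) Z2' by apply: (slid_above_hole _ _ _ _ _ Z1 _ _ H5).
have zZ2' : path leq z Z2'.
  by case: (Z2') aZ2' i1 => //= q Q /andP[/ltnW -> _].
split.
- rewrite s6 /=; apply/and3P; split.
  + apply/allrelP => x w xt; rewrite inE => /orP[/eqP->|wt]; last exact: s5.
    by apply/ltnW/(allP H2).
  + by apply: order_path_min H3; apply: leq_trans.
  + by [].
- rewrite s2 -(sorted_pairwise leq_trans) i1 i2 !andbT; apply/andP; split.
    apply/allrelP => x w xZ wZ; apply: (@leq_trans z); first by apply: s1; rewrite ?mem_head.
    by apply: (allP (order_path_min leq_trans zZ2')).
  rewrite above_catl i4 i3 andbT.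
  by move: aW; rewrite above_catl => /andP[].
- rewrite drop_cat; case: ltnP => cZ.
    have st : size t1 = size (drop c Z1) by rewrite size_drop sZ addKn.
    by rewrite above_cat // H1.
  have t10 : t1 = [::] by case: (t1) sZ cZ => //= ? ? ->; rewrite addnS leqNgt ltnS leq_addr.
  by move: sZ; rewrite t10 addn0 => ->; rewrite subnn drop0.
by rewrite !takel_cat // sZ leq_addr.
Qed.

Lemma slid_shift c B Y B' Y' u k : slid c B Y B' Y' -> sorted leq B ->
  above u (drop k B) -> above u (drop k.+1 B').
Proof.
case=> {c B Y B' Y'} [c B Y _ sB uB|c t1 t2 z Z1 Z2 Z2' W W' _ _ H2 _ _ _ sB uB].
  exact: above_shift.
by apply: above_shiftI => //; case/cat_sorted2: sB.
Qed.

(** * Row insertion is invariant under a slide *)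

Lemma foldl_ins_cat P B s : allrel leq P s ->
  foldl ins (P ++ B) s = P ++ foldl ins B s /\ bumps (P ++ B) s = bumps B s.
Proof.
elim: s B => [|a s IH] B //=; rewrite allrel_consr => /andP[Pa Ps].
have [-> ->] : ins (P ++ B) a = P ++ ins B a /\ bumped (P ++ B) a = bumped B a.
  elim: P Pa {IH Ps} => [|p P IH] //= /andP[pa /IH[-> ->]].
  by rewrite ltnNge pa.
by have [-> ->] := IH (ins B a) Ps.
Qed.

(** Each letter of [s] bumps the letter of [B] just below it; letters beyond the end of [B] are
    appended. *)
Lemma foldl_ins_above B s : sorted leq s -> above s B ->
  foldl ins B s = s /\ bumps B s = B.
Proof.
elim: s B => [|a s IH] [|b B] //= a_s.
  move=> _; have := foldl_ins_cat [:: a] [::] s; rewrite allrel1l.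
  case; first exact: order_path_min leq_trans a_s.
  by have [-> ->] := IH [::] (path_sorted a_s) (above_nil _).
case/andP=> ab sB; rewrite ab /=.
have := foldl_ins_cat [:: a] B s; rewrite allrel1l.
case; first exact: order_path_min leq_trans a_s.
by have [-> ->] := IH B (path_sorted a_s) sB; move=> -> ->.
Qed.

(** Each letter of [s] has its own larger letter in [Rb], so it bumps inside [Ra ++ Rb] and never
    reaches [K]. *)
Lemma foldl_ins_frame Ra Rb K s : size Rb = size s -> above s Rb ->
  foldl ins (Ra ++ Rb ++ K) s = foldl ins (Ra ++ Rb) s ++ K /\
  bumps (Ra ++ Rb ++ K) s = bumps (Ra ++ Rb) s.
Proof.
elim: s Ra Rb => [|a s IH] Ra [|r Rb] //=; first by rewrite cats0.
move=> [sR] /andP[ar sRb].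
have E L : ins (Ra ++ r :: L) a = ins (rcons Ra r) a ++ L /\
           bumped (Ra ++ r :: L) a = bumped (rcons Ra r) a.
  elim: Ra {IH} => [|x Ra IH] /=; first by rewrite ar.
  by case: (ltnP a x) => _ /=; rewrite ?cat_rcons //; case: IH => -> ->.
have [-> ->] := E (Rb ++ K); have [-> ->] := E Rb.
by have [-> ->] := IH (ins (rcons Ra r) a) Rb sR sRb.
Qed.

(** The [j]-th bumped letter is at most the [j]-th letter of [Rb], because insertion bumps the first
    larger letter of a sorted row. The clause on [D] is this domination in the form needed for
    columns. *)
Lemma bumps_leq Ra Rb s : size Rb = size s -> above s Rb -> sorted leq (Ra ++ Rb) ->
  size (bumps (Ra ++ Rb) s) = size s /\
  forall D, above Rb D -> above (bumps (Ra ++ Rb) s) D.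
Proof.
elim: s Ra Rb => [|a s IH] Ra [|r Rb] //= [sR] /andP[ar sRb] sRR.
have E L : ins (Ra ++ r :: L) a = ins (rcons Ra r) a ++ L.
  elim: Ra {IH sRR} => [|x Ra IH] /=; first by rewrite ar.
  by case: (ltnP a x) => _ /=; rewrite ?cat_rcons // IH.
have [d -> dr] : exists2 d, bumped (Ra ++ r :: Rb) a = [:: d] & d <= r.
  elim: Ra sRR {IH E} => [|x Ra IH] /= => [_|xR]; first by rewrite ar; exists r.
  case: (ltnP a x) => _; last exact: IH (path_sorted xR).
  exists x => //; apply: (allP (order_path_min leq_trans xR)).
  by rewrite mem_cat mem_head orbT.
have sI := sorted_ins _ a sRR; rewrite E in sI *.
rewrite /=; have [-> H] := IH _ _ sR sRb sI; split=> // -[|e D] //= /andP[re RD].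
by rewrite H // (leq_ltn_trans dr re).
Qed.

(* Inserting [s1 ++ s2] into [R1 ++ y :: R2] and inserting [s1 ++ y :: s2] into
   the row that has lost [y] give the same row, namely the inserted [s1] part
   followed by [y :: s2]; the words passed on are [b ++ R2] and [b ++ R2'], with
   [b] the letters bumped by [s1], and these are again related by the continuation
   of the slide one row further down. *)
Lemma slid_insert Y c s s' Y' : tab Y -> sorted leq s -> slid c s Y s' Y' ->
  nth [::] (insert_row Y s) =1 nth [::] (insert_row Y' s').
Proof.
elim: Y c s s' Y' => [|R Z IH] c s s' Y' tY ss sl.
  by inversion sl.
move e: (R :: Z) sl => Y sl; case: sl e ss => {c s Y s' Y'} //.
move=> c s1 s2 y R1 R2 R2' Z0 Z' sR H1 H2 H3 H4 H5 [? ?] ss r; subst R Z0.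
case/and3P: tY => sRR aZ tZ.
have ys2 : path leq y s2 by [].
have cR : c <= size R1 by lia.
(* [Ra] lies left of the hole's column, and [Rb] is the part of the row below that supports [s1]
   after its move left. *)
have {H1 sR} : exists Ra Rb, [/\ R1 = Ra ++ Rb, size Ra = c, size Rb = size s1 & above s1 Rb].
  by exists (take c R1), (drop c R1); rewrite cat_take_drop size_takel // size_drop; split=> //; lia.
case=> Ra [Rb [? sRa sRb s1Rb]]; subst R1.
have sR1 : sorted leq (Ra ++ Rb) by case/cat_sorted2: sRR.
have yR2 : path leq y R2 by move: sRR; case/cat_sorted2.
have a2 : above (y :: s2) R2'.
  by apply: (slid_above_hole _ _ _ _ _ (Ra ++ Rb) _ _ H5).
have R'y : all (leq^~ y) (foldl ins (Ra ++ Rb) s1).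
  apply: all_foldl_ins; last by apply: sub_all H2 => x /ltnW.
  move: sRR; rewrite (sorted_pairwise leq_trans) pairwise_cat /= => /andP[/allrelP H _].
  by apply/allP => x xR; apply: H; rewrite ?mem_head.
have allr : allrel leq (foldl ins (Ra ++ Rb) s1) (y :: s2).
  apply/allrelP => x w /(allP R'y) /= xy; rewrite inE => /orP[/eqP->//|ws].
  by apply: leq_trans xy _; apply: (allP (order_path_min leq_trans ys2)).
have fcat S u v : foldl ins S (u ++ v) = foldl ins (foldl ins S u) v /\
    bumps S (u ++ v) = bumps S u ++ bumps (foldl ins S u) v.
  split; first exact: foldl_cat.
  by elim: u S => [|a u IHu] S //=; rewrite IHu catA.
have [E1 E2] : foldl ins ((Ra ++ Rb) ++ y :: R2) (s1 ++ s2) =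
      foldl ins (Ra ++ Rb) s1 ++ y :: s2 /\
    bumps ((Ra ++ Rb) ++ y :: R2) (s1 ++ s2) = bumps (Ra ++ Rb) s1 ++ R2.
  have [-> ->] := fcat ((Ra ++ Rb) ++ y :: R2) s1 s2; rewrite -catA.
  have [-> ->] := foldl_ins_frame Ra Rb (y :: R2) s1 sRb s1Rb.
  rewrite -!cat_rcons.
  have [|-> ->] := foldl_ins_cat (rcons (foldl ins (Ra ++ Rb) s1) y) R2 s2.
    apply/allrelP => x w; rewrite mem_rcons inE => xR ws.
    case/orP: xR => [/eqP->|xR]; first by apply: (allP (order_path_min leq_trans ys2)).
    by apply: (allrelP allr) => //; rewrite inE ws orbT.
  by have [-> ->] := foldl_ins_above R2 s2 (path_sorted ys2) H4.
have [E3 E4] : foldl ins ((Ra ++ Rb) ++ R2') (s1 ++ y :: s2) =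
      foldl ins (Ra ++ Rb) s1 ++ y :: s2 /\
    bumps ((Ra ++ Rb) ++ R2') (s1 ++ y :: s2) = bumps (Ra ++ Rb) s1 ++ R2'.
  have [-> ->] := fcat ((Ra ++ Rb) ++ R2') s1 (y :: s2); rewrite -catA.
  have [-> ->] := foldl_ins_frame Ra Rb R2' s1 sRb s1Rb.
  have [-> ->] := foldl_ins_cat _ R2' _ allr.
  by have [-> ->] := foldl_ins_above R2' (y :: s2) ys2 a2.
rewrite !insert_row_cons E1 E2 E3 E4; case: r => [|r] //=.
have [sb bD] := bumps_leq _ _ _ sRb s1Rb sR1.
have sB : sorted leq (bumps (Ra ++ Rb) s1 ++ R2).
  by rewrite -E2; apply: sorted_bumps.
(* The letters bumped by [s1] take the columns of [Rb] and are dominated by it, so the hole passes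
   them and then continues with [R2] as before. *)
have sl : slid (size Ra) (bumps (Ra ++ Rb) s1 ++ R2) Z (bumps (Ra ++ Rb) s1 ++ R2') Z'.
  apply: slid_prefix; first by rewrite sb -sRb -size_cat.
    by case: (Z) tZ => //= ? ? /and3P[].
  apply: bD; rewrite sb -sRb.
  by move: aZ; rewrite -catA !above_catl => /and3P[].
exact: IH tZ sB sl r.
Qed.

(** Each row bumps the whole row below it, so all rows of [Y] move down by one. *)
Lemma insert_row_above s Y : tab (s :: Y) ->
  nth [::] (insert_row Y s) =1 nth [::] (s :: Y).
Proof.
move=> tY r; elim: Y s tY r => [|R Z IH] s /and3P[ss sR tZ] r.
  rewrite /= in sR; case: r => [|r].
    by rewrite insert_row0 /=; case: (foldl_ins_above [::] s ss sR).
  rewrite insert_rowS /=; case: (foldl_ins_above [::] s ss sR) => _ ->.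
  by rewrite /= !nth_nil.
rewrite insert_row_cons; have [-> ->] := foldl_ins_above R s ss sR.
by case: r => [|r] //=; exact: IH.
Qed.

(** * From the slide function to the rectification of stacked rows *)

Local Notation full := (map (map (@Some nat))).

Lemma set_nth_cat (T : Type) (x0 : T) s1 x y s2 :
  set_nth x0 (s1 ++ x :: s2) (size s1) y = s1 ++ y :: s2.
Proof. by elim: s1 => //= z s1 ->. Qed.

Lemma nth_cat_size (T : Type) (x0 : T) s1 s2 :
  nth x0 (s1 ++ s2) (size s1) = head x0 s2.
Proof. by rewrite nth_cat ltnn subnn nth0. Qed.

Lemma nth_cat_sizeS (T : Type) (x0 x : T) s1 s2 :
  nth x0 (s1 ++ x :: s2) (size s1).+1 = head x0 s2.
Proof. by rewrite nth_cat ltnNge leqnSn subSnn /= nth0. Qed.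

Lemma set_entry_cat top (A : seq (option nat)) h B Y v :
  set_entry (top ++ (A ++ h :: B) :: Y) (size top) (size A) v =
  top ++ (A ++ v :: B) :: Y.
Proof. by rewrite /set_entry nth_cat_size !set_nth_cat. Qed.

Lemma entry_below top (A : seq (option nat)) B Y c :
  entry (top ++ (A ++ B) :: full Y) (size top).+1 c =
  if c < size (head [::] Y) then Some (nth 0 (head [::] Y) c) else None.
Proof.
rewrite /entry nth_cat_sizeS; case: Y => [|R Y] /=; first by rewrite nth_nil.
by case: ltnP => cR; [rewrite (nth_map 0) | rewrite nth_default ?size_map].
Qed.

(** [h] is the old content of the hole: a moved letter is copied, and its former box becomes the
    next hole. The fuel bounds the letters that can still move. *)
Lemma slideP fuel top A h B Y :
  size B + size (flatten Y) < fuel -> tab Y -> sorted leq B ->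
  above B (drop (size A).+1 (head [::] Y)) ->
  exists B' Y', slid (size A) B Y B' Y' /\
    slide fuel (top ++ (A ++ h :: map Some B) :: full Y) (size top) (size A) =
    top ++ (A ++ map Some B') :: full Y'.
Proof.
elim: fuel top A h B Y => [//|fuel IH] top A h B Y /= lt_fuel tY sB BY.
have sY : sorted leq (head [::] Y) by case: (Y) tY => //= ? ? /and3P[].
rewrite entry_below.
rewrite {1}/entry nth_cat_size /= nth_cat_sizeS.
have right b B1 : B = b :: B1 ->
    (size A < size (head [::] Y) -> b < nth 0 (head [::] Y) (size A)) ->
    exists B' Y', slid (size A) B Y B' Y' /\
      slide fuel (top ++ (A ++ Some b :: map Some B) :: full Y) (size top) (size A).+1 =
      top ++ (A ++ map Some B') :: full Y'.
  move=> eB bY; rewrite eB /= in lt_fuel sB BY *.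
  have [] := IH top (rcons A (Some b)) (Some b) B1 Y _ tY (path_sorted sB).
  - lia.
  - rewrite size_rcons; case: (ltnP (size A).+1 (size (head [::] Y))) => cY.
      by move: BY; rewrite (drop_nth 0) //= => /andP[].
    by rewrite drop_oversize ?above_nil //; lia.
  move=> B' [Y' [sl eq_sl]]; exists (b :: B'), Y'; split.
    by apply: slid_cons => //; rewrite size_rcons in sl.
  by move: eq_sl; rewrite size_rcons !cat_rcons.
have down : size A < size (head [::] Y) ->
    path leq (nth 0 (head [::] Y) (size A)) B ->
    exists B' Y', slid (size A) B Y B' Y' /\
      slide fuel (top ++ (A ++ Some (nth 0 (head [::] Y) (size A)) :: map Some B) :: full Y)
        (size top).+1 (size A) =
      top ++ (A ++ map Some B') :: full Y'.
  case: Y tY lt_fuel BY {sY right} => [//|R Z] /and3P[sR aZ tZ] lt_fuel BY /= cR yB.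
  set y := nth 0 R (size A) in yB *.
  have eR : R = take (size A) R ++ y :: drop (size A).+1 R.
    by rewrite -drop_nth // cat_take_drop.
  have sA : size (take (size A) R) = size A by rewrite size_takel // ltnW.
  have sRfl : size (drop (size A).+1 R) < size R by rewrite size_drop; lia.
  have [] := IH (rcons top (A ++ Some y :: map Some B)) (map Some (take (size A) R))
     (Some y) (drop (size A).+1 R) Z _ tZ.
  - by move: lt_fuel; rewrite /= size_cat; lia.
  - by rewrite drop_sorted.
  - by rewrite size_map sA above_drop.
  move=> B' [Y' []]; rewrite !size_map sA => sl eq_sl.
  exists (y :: B), ((take (size A) R ++ B') :: Y'); split.
    (* A move down is [slid_down] with [t1] empty; moves right before it are prepended by
       [slid_cons]. *)
    have := slid_down (size A) [::] B y (take (size A) R) (drop (size A).+1 R) B' Z Y'.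
    rewrite -eR sA /= addn0; apply=> //; first by rewrite drop_oversize ?sA.
  have eF : map Some R =
      map Some (take (size A) R) ++ Some y :: map Some (drop (size A).+1 R).
    by rewrite {1}eR map_cat.
  by move: eq_sl; rewrite size_rcons !cat_rcons -eF /= map_cat.
have [eB|[b [B1 eB]]] : B = [::] \/ exists b B1, B = b :: B1.
  by case: (B) => [|b B1]; [left | right; exists b, B1].
- have -> : head None (map Some B) = None by rewrite eB.
  case: ltnP => cY; first by rewrite set_entry_cat; apply: down; rewrite ?eB.
  exists B, Y; split; first by apply: slid_stop; rewrite drop_oversize ?above_nil.
  by rewrite set_nth_cat take_size_cat // eB cats0.
have -> : head None (map Some B) = Some b by rewrite eB.
case: ltnP => cY; last by rewrite set_entry_cat; apply: (right b B1) => //; lia.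
case: leqP => yb; rewrite set_entry_cat; last exact: (right b B1 eB).
by apply: down => //; rewrite eB /= yb; rewrite eB in sB.
Qed.

Lemma inner_size_nseq m s : count_mem None (nseq m None ++ map (@Some nat) s) = m.
Proof.
rewrite count_cat count_nseq /= mul1n count_map.
by rewrite (@eq_count _ _ pred0) ?count_pred0 ?addn0.
Qed.

(** The rows of [Y] contain no [None], so the lowest inside corner is the last [None] of the row
    just above them. *)
Lemma jdt_stepP top m s Y : tab Y -> sorted leq s ->
  above s (drop m.+1 (head [::] Y)) ->
  exists s' Y', slid m s Y s' Y' /\
    jdt_step (top ++ (nseq m.+1 None ++ map Some s) :: full Y) =
    top ++ (nseq m None ++ map Some s') :: full Y'.
Proof.
move=> tY ss sY; set X := top ++ _.
have nthX : nth [::] X (size top) = nseq m.+1 None ++ map Some s.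
  by rewrite nth_cat_size.
have rowsE : exists l,
    [seq r <- iota 0 (size X) | 0 < inner_size X r] = rcons l (size top).
  exists [seq r <- iota 0 (size top) | 0 < inner_size X r].
  rewrite size_cat /= iotaD filter_cat /= add0n /inner_size nthX inner_size_nseq /=.
  rewrite -cats1; congr (_ ++ _ :: _); apply/eqP; rewrite -[_ == _]negbK -has_filter.
  apply/hasPn => r; rewrite mem_iota => /andP[r1 _].
  rewrite /X nth_cat; case: (ltnP r (size top)) => [r2|_]; first by rewrite ltnNge (ltnW r1) in r2.
  have -> : r - size top = (r - (size top).+1).+1 by lia.
  case: (ltnP (r - (size top).+1) (size Y)) => rY.
    by rewrite /= (nth_map [::]) //; have /= -> := inner_size_nseq 0 (nth [::] Y (r - (size top).+1)).
  by rewrite /= nth_default ?size_map.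
case: rowsE => l rowsE; rewrite /jdt_step rowsE.
have iX : inner_size X (size top) = m.+1 by rewrite /inner_size nthX inner_size_nseq.
have eX : X = top ++ (nseq m None ++ None :: map Some s) :: full Y.
  by rewrite /X -addn1 nseqD -catA.
have [||//||s' [Y' [sl eq_sl]]] := slideP (size (flatten X)) top (nseq m None) None s Y.
- by rewrite eX flatten_cat /= !size_cat /= size_map -(map_flatten Some) size_map; lia.
- by [].
- by rewrite size_nseq.
exists s', Y'; rewrite size_nseq in sl eq_sl; split=> //.
by case: l {rowsE} => [|r0 l] /=; rewrite ?last_rcons iX -eq_sl -eX.
Qed.

(* The last clause keeps the column condition against the row [u] above [s]. *)
Lemma row_slides m top s Y : tab Y -> sorted leq s ->
  above s (drop m (head [::] Y)) ->
  exists s' Y',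
  [/\ iter m jdt_step (top ++ (nseq m None ++ map Some s) :: full Y) =
        top ++ full (s' :: Y'),
      tab (s' :: Y'),
      nth [::] (insert_row Y s) =1 nth [::] (s' :: Y')
    & forall u k, above u (drop k s) -> above u (drop (k + m) s')].
Proof.
elim: m s Y => [|m IH] s Y tY ss sY.
  have tsY : tab (s :: Y) by rewrite /= ss -(drop0 (head _ _)) sY.
  by exists s, Y; split=> // [|u k]; [exact: insert_row_above | rewrite addn0].
have [s1 [Y1 [sl eq_sl]]] := jdt_stepP top m s Y tY ss sY.
have [ss1 tY1 sY1 _] := slid_tab _ _ _ _ _ sl tY ss.
have [s' [Y' [e t i sh]]] := IH s1 Y1 tY1 ss1 sY1.
exists s', Y'; split=> //.
- by rewrite iterSr eq_sl.
- by move=> r; rewrite -i; apply: (slid_insert _ _ _ _ _ tY ss sl).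
by move=> u k us; rewrite addnS -addSn; apply/sh/(slid_shift _ _ _ _ _ _ _ sl ss us).
Qed.

Fixpoint chain (L : nat) (us : seq (seq nat)) (Y : seq (seq nat)) : bool :=
  if us is u :: us' then
    [&& sorted leq u,
        (if us' is v :: _ then above u v else above u (drop L (head [::] Y)))
      & chain L us' Y]
  else true.

(** The lowest row is brought in first, by [L] slides; [foldr] inserts the rows in the same
    order. *)
Lemma rectify L us Y : tab Y -> chain L us Y ->
  exists Y', [/\ iter (size us * L) jdt_step
                   ([seq nseq L None ++ map Some u | u <- us] ++ full Y) = full Y',
                 tab Y'
               & nth [::] (foldr (fun s S => insert_row S s) Y us) =1 nth [::] Y'].
Proof.
elim/last_ind: us Y => [|us u IH] Y tY; first by exists Y.
move=> ch.
have [su uY] : sorted leq u /\ above u (drop L (head [::] Y)).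
  by elim: us ch {IH} => [|v us IHu] /= /and3P[].
have [s' [Y' [e t i sh]]] :=
  row_slides L [seq nseq L None ++ map Some u | u <- us] u Y tY su uY.
(* The row now starts at the left border, so the next row up meets it from column [L] on; this is
   [sh] with [k = 0]. *)
have ch' : chain L us (s' :: Y').
  elim: us ch {IH e} => [|v us IHu] //= /and3P[-> vu /IHu ->]; rewrite andbT /=.
  by case: (us) vu => //= vu; rewrite -(add0n L) sh ?drop0.
have [Y2 [e2 t2 i2]] := IH _ t ch'.
exists Y2; split=> //.
  by rewrite size_rcons mulSn addnC iterD map_rcons cat_rcons e.
move=> r; rewrite -i2 foldr_rcons.
elim: us r {IH ch e ch' e2 i2} => [|v us IHu] r /=; first exact: i.
exact: eq_insert_row.
Qed.

(** * The solution of the octahedron recurrence *)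

Lemma tabP Y : reflect
  (forall r, sorted leq (nth [::] Y r) /\ above (nth [::] Y r) (nth [::] Y r.+1)) (tab Y).
Proof.
apply: (iffP idP) => [|].
  elim: Y => [_ r|R Z IH /and3P[sR aZ tZ] [|r]] //=; first by rewrite nth_nil.
  exact: IH.
elim: Y => [|R Z IH] //= H; rewrite IH => [|r]; last exact: (H r.+1).
by have [/= -> ] := H 0; rewrite nth0 => ->.
Qed.

Lemma tableau_row n T : tableau n T -> forall r, sorted leq (nth [::] T r) /\
  all (fun a => 1 <= a <= n) (nth [::] T r).
Proof.
case=> sT aT _ r; case: (ltnP r (size T)) => rT; last by rewrite nth_default.
by split; [apply: sT | apply: aT]; rewrite mem_nth.
Qed.

Lemma tableau_above n T : tableau n T -> forall r, above (nth [::] T r) (nth [::] T r.+1).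
Proof. by case=> _ _ cT r; apply/above_nthP => j /cT. Qed.

Lemma tableau_gt n T : tableau n T -> forall r, all (ltn r) (nth [::] T r).
Proof.
move=> tT; elim=> [|r IH].
  by have [_] := tableau_row _ _ tT 0; apply: sub_all => a /andP[].
apply/(all_nthP 0) => j /(above_nthP _ _ (tableau_above _ _ tT r) j)[jr].
by move/(all_nthP 0): IH => /(_ _ jr) /=; lia.
Qed.

Lemma tableau_row_nil n T : tableau n T -> forall r, n <= r -> nth [::] T r = [::].
Proof.
move=> tT r nr; have [_] := tableau_row _ _ tT r; have := tableau_gt _ _ tT r.
by case: (nth [::] T r) => [|a s] //= /andP[ra _] /andP[]; lia.
Qed.

Lemma nth_mkseq_tableau n T : tableau n T -> nth [::] (mkseq (nth [::] T) n) =1 nth [::] T.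
Proof.
move=> tT r; case: (ltnP r n) => rn; first by rewrite nth_mkseq.
by rewrite nth_default ?size_mkseq // (tableau_row_nil _ _ tT).
Qed.

Lemma sorted_insert_row T s : (forall r, sorted leq (nth [::] T r)) ->
  forall r, sorted leq (nth [::] (insert_row T s) r).
Proof.
move=> sT r; elim: r T s sT => [|r IH] T s sT.
  by rewrite insert_row0 -nth0 sorted_foldl_ins.
by rewrite insert_rowS; apply: IH => k; rewrite nth_behead.
Qed.

Lemma JstageE T U k : Jstage T U k = insert_row (Jstage T U k.+1) (nth [::] U k).
Proof.
rewrite /Jstage; case: (ltnP k (size U)) => kU; first by rewrite (drop_nth [::]).
by rewrite nth_default // !drop_oversize // leqW.
Qed.

Lemma Jstage_ind (P : seq (seq nat) -> Prop) T U :
  P T -> (forall k S, P S -> P (insert_row S (nth [::] U k))) ->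
  forall k, P (Jstage T U k).
Proof.
move=> PT PS k; move e: (size U - k) => d; elim: d k e => [|d IH] k e.
  by rewrite /Jstage drop_oversize //; lia.
by rewrite JstageE; apply: PS; apply: IH; lia.
Qed.

Lemma Jstage_id T U k : (forall r, k <= r -> nth [::] U r = [::]) -> Jstage T U k = T.
Proof.
move e: (size U - k) => d; elim: d k e => [|d IH] k e H.
  by rewrite /Jstage drop_oversize //; lia.
by rewrite JstageE H // IH //; [lia | move=> r kr; apply: H; lia].
Qed.

Lemma eq_Jstage T T' U U' k : nth [::] T =1 nth [::] T' -> nth [::] U =1 nth [::] U' ->
  nth [::] (Jstage T U k) =1 nth [::] (Jstage T' U' k).
Proof.
move=> eT eU; move e: (maxn (size U) (size U') - k) => d; elim: d k e => [|d IH] k e.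
  by rewrite /Jstage !drop_oversize //; lia.
rewrite (JstageE T) (JstageE T') eU; apply: eq_insert_row; apply: IH; lia.
Qed.

Lemma J_star n T U : tableau n T -> tableau n U ->
  exists2 Y, J (star n T U) = Y &
    tab Y /\ nth [::] (Jstage T U 0) =1 nth [::] Y.
Proof.
move=> tT tU.
set us := mkseq (nth [::] U) n; set Y := mkseq (nth [::] T) n.
set L := size (head [::] T).
have starE : star n T U = [seq nseq L None ++ map Some u | u <- us] ++ full Y.
  by rewrite /star /us /Y /mkseq -!map_comp.
have tY : tab Y.
  apply/tabP => r; rewrite !(nth_mkseq_tableau _ _ tT).
  by split; [case: (tableau_row _ _ tT r) | exact: tableau_above tT r].
(* No row of [T] reaches beyond column [L], so the last row of the upper block has nothing below
   it. *)
have YL : drop L (head [::] Y) = [::].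
  by rewrite -nth0 (nth_mkseq_tableau _ _ tT) nth0 drop_size.
have ch k m : chain L [seq nth [::] U r | r <- iota k m] Y.
  elim: m k => [|m IH] k //=.
  have [-> _] := tableau_row _ _ tU k; rewrite IH andbT /=.
  by case: m {IH} => [|m] /=; [rewrite YL above_nil | exact: tableau_above tU k].
have [Y' [e t i]] := rectify L us Y tY (ch 0 n).
exists Y'; last first.
  split=> // r; rewrite -i.
  rewrite (eq_Jstage _ Y _ us) => [|k|k].
  - by rewrite /Jstage drop0.
  - by rewrite (nth_mkseq_tableau _ _ tT).
  - by rewrite (nth_mkseq_tableau _ _ tU).
have cE : count_mem None (flatten (star n T U)) = size us * L.
  rewrite starE flatten_cat count_cat.
  have -> : count_mem None (flatten (full Y)) = 0.
    by rewrite -map_flatten; exact: (inner_size_nseq 0).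
  rewrite addn0; elim: (us) => [|u vs IH] //=.
  by rewrite count_cat inner_size_nseq IH mulSn.
rewrite /J cE starE e -map_comp -[RHS]map_id; apply: eq_map => s /=.
by elim: s => //= a s ->.
Qed.

(** * Row sums of the stages and the solution formula *)

Lemma rowsumSr V i b : rowsum V i b.+1 = rowsum V i b + cnt i (nth [::] V b).
Proof. by rewrite /rowsum big_ord_recr. Qed.

(** No letter exceeds [n], so at [i = n] counting letters is counting boxes. *)
Lemma sumn_drop_shape n V b : (forall r, all (fun a => a <= n) (nth [::] V r)) ->
  sumn (drop b (shape V)) + rowsum V n b = sumn (shape V).
Proof.
move=> nV; elim: V b nV => [|R Z IH] [|b] nV; rewrite ?drop0 ?rowsum0 ?addn0 //.
  by rewrite /rowsum big1 // => r _; rewrite nth_nil.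
have := nV 0; rewrite /= all_count -/(cnt _ _) => /eqP sR.
by rewrite rowsumS /= sR -(IH b) => [|r]; [rewrite addnCA | exact: (nV r.+1)].
Qed.

(** Going from [c+1] to [c] moves row [c] of [U] into the tableau. Its letters exceed [c], so those
    [<= i] stay in the first [b] rows and the sum is unchanged. *)
Lemma rowsum_Jstage T U i b c m : c <= m -> i <= b + c ->
  (forall r, all (ltn r) (nth [::] U r)) ->
  rowsum (Jstage T U c) i b + rowsum U i c = rowsum (Jstage T U m) i b + rowsum U i m.
Proof.
move=> cm; move e: (m - c) => d ic gU; elim: d c cm ic e => [|d IH] c cm ic e.
  by have -> : c = m by lia.
rewrite -(IH c.+1); [|lia..].
by rewrite rowsumSr JstageE (rowsum_insert_row_gt _ _ _ _ c) //; lia.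
Qed.

Lemma rowsum_stable U i m : (forall r, all (ltn r) (nth [::] U r)) -> i <= m ->
  rowsum U i m = rowsum U i i.
Proof.
move=> gU im; rewrite -(subnKC im); elim: (m - i) => [|d IH]; first by rewrite addn0.
rewrite addnS rowsumSr IH; suff -> : cnt i (nth [::] U (i + d)) = 0 by rewrite addn0.
apply/eqP; rewrite -leqn0 leqNgt -has_count; apply/hasPn => x /(allP (gU _)) /=; lia.
Qed.

Local Open Scope ring_scope.

(** [hat] telescopes along the line [z = n - i], starting at [(i, 0, n - i)]. *)
Lemma hat_sum n G V i b :
  (forall j, (1 <= j <= i)%N -> (pattern V i j)%:Z = hat n G i j) -> (b <= i)%N ->
  G (i%:Z - b%:Z) b%:Z (n%:Z - i%:Z) = G i%:Z 0 (n%:Z - i%:Z) + (rowsum V i b)%:Z.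
Proof.
move=> H; elim: b => [|b IH] bi; first by rewrite rowsum0 subr0 addr0.
have := H b.+1 bi; rewrite /hat rowsumSr /pattern /= -/(cnt _ _).
have -> : i%:Z - b.+1%:Z + 1 = i%:Z - b%:Z by lia.
have -> : b.+1%:Z - 1 = b%:Z by lia.
by have := IH (ltnW bi); lia.
Qed.

(* With a = (t+x-y)/2, b = (t-x+y)/2, c = (x+y-t)/2 and i = a+b+c, the point
   (x, y, t) is (i-b, b+c, i-c), and the recurrence at it becomes
   [rowsum_insert_row]. *)
Lemma octahedron_rowsum n (M N f : int -> int -> int -> int) T U :
  (forall k : nat, (k <= n)%N ->
     M k%:Z 0 (n%:Z - k%:Z) = N 0 k%:Z (n%:Z - k%:Z)) ->
  octahedron n M N f ->
  tableau_of n (hat n M) T -> tableau_of n (hat n N) U ->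
  forall i b c : nat, (i <= n)%N -> (b + c <= i)%N ->
  f (i%:Z - b%:Z) (b%:Z + c%:Z) (i%:Z - c%:Z) =
  N i%:Z 0 (n%:Z - i%:Z) + (rowsum U i c)%:Z + (rowsum (Jstage T U c) i b)%:Z.
Proof.
move=> MN [fM fN fS] [tT hT] [tU hU] i b c.
have gU := tableau_gt _ _ tU.
have JT : Jstage T U n = T by apply: Jstage_id => r; apply: tableau_row_nil tU r.
have hatM i' b' : (i' <= n)%N -> (b' <= i')%N -> M (i'%:Z - b'%:Z) b'%:Z (n%:Z - i'%:Z) =
    M i'%:Z 0 (n%:Z - i'%:Z) + (rowsum T i' b')%:Z.
  by move=> i'n; apply: hat_sum => j /hT; apply.
have hatN i' b' : (i' <= n)%N -> (b' <= i')%N -> N (i'%:Z - b'%:Z) b'%:Z (n%:Z - i'%:Z) =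
    N i'%:Z 0 (n%:Z - i'%:Z) + (rowsum U i' b')%:Z.
  by move=> i'n; apply: hat_sum => j /hU; apply.
(* Induction on the height [t = i - c]; the case [b = 0] is the face given by [N]. *)
have [m] := ubnP (i - c)%N; elim: m i b c => [//|m IH] i b c ltm i_n bci.
case: b bci => [|b] bci.
  have := fN (i%:Z - c%:Z) c%:Z (n%:Z - i%:Z).
  have -> : n%:Z - (n%:Z - i%:Z) = i%:Z by lia.
  by rewrite rowsum0 subr0 add0r addr0 -hatN // => -> //; rewrite /Delta; lia.
(* The face given by [M]: there [rowsum_Jstage] leads from stage [c] to stage [n], which is [T]. *)
case: (eqVneq (b.+1 + c)%N i) => [ei|ni].
  have := fM c%:Z b.+1%:Z (n%:Z - i%:Z).
  have -> : n%:Z - (n%:Z - i%:Z) = i%:Z by lia.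
  have -> : i%:Z - b.+1%:Z = c%:Z by lia.
  have -> : b.+1%:Z + c%:Z = i%:Z by lia.
  have -> : i%:Z - c%:Z = b.+1%:Z by lia.
  move=> ->; last by rewrite /Delta; lia.
  have := hatM i b.+1 i_n; have -> : i%:Z - b.+1%:Z = c%:Z by lia.
  move=> ->; last lia.
  rewrite MN //; have := hatN i i i_n (leqnn i); rewrite subrr => ->.
  have := rowsum_Jstage T U i b.+1 c n; rewrite JT (rowsum_stable _ _ _ gU i_n).
  by move=> /(_ _ _ gU) H; have := H ltac:(lia) ltac:(lia); lia.
case: i ltm i_n bci ni => [|i] ltm i_n bci ni; first by lia.
have bci' : (b + c < i)%N by lia.
have := fS (i%:Z - b%:Z) (b.+1%:Z + c%:Z) (i%:Z - c%:Z).
have -> : i%:Z - c%:Z + 1 = i.+1%:Z - c%:Z by lia.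
have -> : i.+1%:Z - b.+1%:Z = i%:Z - b%:Z by lia.
move=> -> /=; first last.
- by lia.
- by rewrite /regionA; lia.
- rewrite /lattice; apply/and3P; split; [lia..|].
  by apply/dvdzP; exists i.+1%:Z; lia.
(* At [(i+1, b+1, c)] the two sums pair [(i+1, b, c+1)] with [(i, b+1, c)] and [(i+1, b+1, c+1)]
   with [(i, b, c)]; the subtracted point is [(i, b, c+1)]. *)
have := IH i b c.+1 _ _ _; have := IH i.+1 b c.+1 _ _ _.
have := IH i b.+1 c _ _ _; have := IH i.+1 b.+1 c.+1 _ _ _.
have := IH i b c _ _ _.
have -> : i%:Z - b%:Z + 1 = i.+1%:Z - b%:Z by lia.
have -> : i%:Z - b%:Z - 1 = i%:Z - b.+1%:Z by lia.
have -> : i%:Z - c%:Z - 1 = i%:Z - c.+1%:Z by lia.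
have -> : b.+1%:Z + c%:Z + 1 = b.+1%:Z + c.+1%:Z by lia.
have -> : b.+1%:Z + c%:Z - 1 = b%:Z + c%:Z by lia.
have -> : i.+1%:Z - b.+1%:Z = i%:Z - b%:Z by lia.
have -> : i.+1%:Z - c.+1%:Z = i%:Z - c%:Z by lia.
have -> : b.+1%:Z + c%:Z = b%:Z + c.+1%:Z by lia.
do 5 (move=> ->; [|lia..]).
have sJ := Jstage_ind (fun S => forall r, sorted leq (nth [::] S r)) T U
  (fun r => (tableau_row _ _ tT r).1) (fun k S => @sorted_insert_row S _) c.+1.
have := rowsum_insert_row _ _ i b sJ (tableau_row _ _ tU c).1.
rewrite -JstageE !(rowsumSr U).
lia.
Qed.

(** * Reading both hives off the faces of the solution *)

Lemma all_Jstage n T U k r : tableau n T -> tableau n U ->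
  all (fun a => 1 <= a <= n)%N (nth [::] (Jstage T U k) r).
Proof.
move=> tT tU; move: r.
apply: (Jstage_ind (fun S => forall r, all (fun a => 1 <= a <= n)%N (nth [::] S r))).
  by move=> r; case: (tableau_row _ _ tT r).
by move=> c S HS; apply: all_insert_row => //; case: (tableau_row _ _ tU c).
Qed.

Theorem theorem7p9 (n : nat) (lam mu nu del rho : n.-tuple nat)
    (M N f : int -> int -> int -> int) (T U : seq (seq nat)) :
  partition_n lam -> partition_n mu -> partition_n nu ->
  partition_n del -> partition_n rho ->
  HIVE lam del rho M -> HIVE mu nu del N ->
  (forall k : nat, (k <= n)%N ->
     M k%:Z 0 (n%:Z - k%:Z) = N 0 k%:Z (n%:Z - k%:Z)) ->
  octahedron n M N f ->
  tableau_of n (hat n M) T -> tableau_of n (hat n N) U ->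
  (forall i j : nat, (1 <= j <= i)%N -> (i <= n)%N ->
     Rpat T U i j = hat n (hiveP n f) i j)
  /\ tableau_of n (hat n (hiveQ n f)) (J (star n T U)).
Proof.
move=> _ _ _ _ _ _ _ MN oct TM UN.
have fE := @octahedron_rowsum n M N f T U MN oct TM UN.
case: TM UN => tT _ [tU _]; split.
  move=> i [//|j] ji i_n; rewrite /hat /hiveP.
  (* [hiveP] at [(i-j, j, n-i)] is the solution at the triple [(n, j, i-j)]; here [j] is written
     [j.+1]. *)
  have := fE n j.+1 (i - j.+1)%N (leqnn n); have := fE n j (i - j.+1).+1%N (leqnn n).
  have -> : n%:Z - (n%:Z - i%:Z) = i%:Z by lia.
  have -> : n%:Z - (j.+1%:Z - 1) = n%:Z - j%:Z by lia.
  have -> : n%:Z - (i%:Z - j.+1%:Z) = n%:Z - (i - j.+1)%N%:Z by lia.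
  have -> : n%:Z - (i%:Z - j.+1%:Z + 1) = n%:Z - (i - j.+1).+1%:Z by lia.
  have -> : j%:Z + (i - j.+1).+1%:Z = i%:Z by lia.
  have -> : j.+1%:Z + (i - j.+1)%N%:Z = i%:Z by lia.
  move=> -> ; last lia; move=> ->; last lia.
  have leJ k r : all (fun a => a <= n)%N (nth [::] (Jstage T U k) r).
    by apply: sub_all (all_Jstage n T U k r tT tU) => a /andP[].
  have := sumn_drop_shape n _ j.+1 (leJ (i - j.+1)%N).
  have := sumn_drop_shape n _ j (leJ (i - j.+1).+1%N).
  rewrite /Rpat /tail_size /= rowsumSr (rowsumSr U).
  (* The box counts of stages [c] and [c+1], with [c = i - j.+1], differ by the length of row [c] of
     [U], which cancels its contribution to [rowsum U]. *)
  have := sumn_shape_insert_row (Jstage T U (i - j.+1).+1) (nth [::] U (i - j.+1)).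
  rewrite -JstageE.
  have : cnt n (nth [::] U (i - j.+1)) = size (nth [::] U (i - j.+1)).
    have [_] := tableau_row _ _ tU (i - j.+1)%N.
    have sub : subpred (fun a => 1 <= a <= n)%N (fun a => a <= n)%N by move=> a /andP[].
    by move/(sub_all sub); rewrite all_count => /eqP.
  lia.
have [Y -> [tY YJ]] := J_star n T U tT tU.
split; first split.
- by move=> s /(nthP [::])[r _ <-]; case: (elimT (tabP Y) tY r).
- by move=> s /(nthP [::])[r _ <-]; rewrite -YJ all_Jstage.
- move=> r c cY; apply: (above_nthP _ _ _ c cY).
  by case: (elimT (tabP Y) tY r).
move=> i [//|j] ji i_n; rewrite /hat /hiveQ.
have -> : n%:Z - (n%:Z - i%:Z) = i%:Z by lia.
have fQ b : (b <= i)%N -> f (i%:Z - b%:Z) b%:Z i%:Z =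
    N i%:Z 0 (n%:Z - i%:Z) + (rowsum U i 0)%:Z + (rowsum (Jstage T U 0) i b)%:Z.
  by move=> bi; rewrite -fE ?addn0 //; congr f; lia.
have -> : i%:Z - j.+1%:Z + 1 = i%:Z - j%:Z by lia.
have -> : j.+1%:Z - 1 = j%:Z by lia.
rewrite fQ ?fQ; [|lia..].
rewrite rowsumSr /pattern /= -YJ -/(cnt _ _); lia.
Qed.
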